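(* For all integers $n\geq 0$, we have $$B(2n+1)\equiv 0\pmod{2}\qquad\text{and}\qquad B(5n+4)\equiv 0\pmod{5}.$$
   Context: For $m\in\mathbb{N}$ and $|q|<1$ let $f_m:=\prod_{n\geq 1}(1-q^{mn})$. $B(n)$ denotes the number of partition triples $\pi=(\pi_1,\pi_2,\pi_3)$ of $n$ (the sum of all parts of $\pi_1,\pi_2,\pi_3$ is $n$; empty partitions are allowed) such that $\pi_1$ and $\pi_2$ each consist of distinct odd parts and $\pi_3$ consists of parts divisible by $4$. Equivalently, $\sum_{n=0}^\infty B(n)q^n=\dfrac{f_2^4}{f_1^2f_4^3}$. *)

(* Defs.v *)
From mathcomp Require Import all_boot.

Set Implicit Arguments.
Unset Strict Implicit.
Unset Printing Implicit Defensive.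

(* A partition is its nonincreasing list of positive parts, [::] included. *)
Definition is_partition (s : seq nat) : bool := sorted geq s && (0 \notin s).

Definition distinct_odd_parts (s : seq nat) : bool := uniq s && all odd s.

Definition parts_dvd4 (s : seq nat) : bool := all (dvdn 4) s.

Definition admissible_triple (n : nat) (p : seq nat * seq nat * seq nat) : bool :=
  let: (s1, s2, s3) := p in
  [&& is_partition s1, is_partition s2, is_partition s3,
      sumn s1 + sumn s2 + sumn s3 == n,
      distinct_odd_parts s1, distinct_odd_parts s2 & parts_dvd4 s3].

(* The components of an admissible triple of n have at most n parts, each at
   most n, so they are counted inside the finite type of sequences of length at
   most n with entries in 'I_n.+1; B_count shows that none is missed. *)
Definition bounded_triple (n : nat) : finType :=
  (n.-bseq 'I_n.+1 * n.-bseq 'I_n.+1 * n.-bseq 'I_n.+1)%type.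

Definition seqs_of_triple (n : nat) (p : bounded_triple n) :
    seq nat * seq nat * seq nat :=
  (map val p.1.1, map val p.1.2, map val p.2).

Definition B (n : nat) : nat :=
  #|[set p : bounded_triple n | admissible_triple n (seqs_of_triple p)]|.

Lemma seqs_of_triple_inj (n : nat) : injective (@seqs_of_triple n).
Proof.
have inj (s t : n.-bseq 'I_n.+1) : map val s = map val t -> s = t.
  by move=> /(inj_map val_inj) st; apply: val_inj.
by move=> [[a b] c] [[a' b'] c'] [/inj -> /inj -> /inj ->].
Qed.

Lemma partition_bseq (n : nat) (s : seq nat) :
  is_partition s -> sumn s <= n ->
  exists t : n.-bseq 'I_n.+1, map val t = s.
Proof.
move=> /andP[_ s0] sn.
have size_s : size s <= n.
  apply: leq_trans sn; elim: s s0 => //= x s IHs.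
  rewrite inE negb_or => /andP[x0 /IHs le].
  by rewrite -add1n leq_add // lt0n eq_sym.
have lt_s x : x \in s -> x < n.+1.
  move=> xs; rewrite ltnS; apply: leq_trans sn.
  elim: s xs {s0 size_s} => //= y s IHs.
  rewrite inE => /orP[/eqP -> | /IHs le]; first exact: leq_addr.
  by apply: leq_trans le _; exact: leq_addl.
have size_t : size (map (@inord n) s) <= n by rewrite size_map.
exists (Bseq size_t) => /=; rewrite -map_comp -[RHS]map_id.
by apply/eq_in_map => x /lt_s /= xn; rewrite inordK.
Qed.

Lemma B_enum (n : nat) :
  exists L : seq (seq nat * seq nat * seq nat),
    [/\ uniq L, forall p, (p \in L) = admissible_triple n p & size L = B n].
Proof.
exists (map (@seqs_of_triple n)
  (enum [set p | admissible_triple n (@seqs_of_triple n p)])).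
split; last by rewrite size_map -cardE.
  by rewrite map_inj_uniq ?enum_uniq //; exact: seqs_of_triple_inj.
move=> p; apply/mapP/idP => [[q]|adm].
  by rewrite mem_enum inE => adm ->.
case: p adm => [[s1 s2] s3] adm.
have /and5P[p1 p2 p3 /eqP sum _] := adm.
have [t1 e1] : exists t : n.-bseq 'I_n.+1, map val t = s1.
  by apply: partition_bseq; rewrite // -sum -addnA leq_addr.
have [t2 e2] : exists t : n.-bseq 'I_n.+1, map val t = s2.
  by apply: partition_bseq; rewrite // -sum addnAC leq_addl.
have [t3 e3] : exists t : n.-bseq 'I_n.+1, map val t = s3.
  by apply: partition_bseq; rewrite // -sum leq_addl.
exists (t1, t2, t3); last by rewrite /seqs_of_triple /= e1 e2 e3.
by rewrite mem_enum inE /seqs_of_triple /= e1 e2 e3.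
Qed.

Lemma B_count (n : nat) (L : seq (seq nat * seq nat * seq nat)) :
  uniq L -> (forall p, (p \in L) = admissible_triple n p) -> B n = size L.
Proof.
move=> uL memL; have [M [uM memM <-]] := B_enum n.
by apply/perm_size/uniq_perm => // p; rewrite memM memL.
Qed.

(* Main.v *)
Require Import Defs.
From mathcomp Require Import all_boot all_algebra zify ring.

Set Implicit Arguments.
Unset Strict Implicit.
Unset Printing Implicit Defensive.

Import GRing.Theory.

(** Let A(q) = prod (1 + q^(2i-1)), P(q) = prod 1 / (1 - q^(4i)) and
f_d = prod (1 - q^(d i)); the generating function of B is G = A^2 P.

Parity.  Over 'F_2 the derivative of G vanishes, because A^2 is a square and
every exponent in P is even; hence G has no odd exponents (coef_deriv0).

Modulo 5.  From A f_1 f_4 = f_2^2 and P f_4 = 1 follows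
  G (f_1 f_4)^5 = f_2^5 . f_1^3 . (f_4^2 / f_2).
Jacobi's identity (jacobi_cube) and Gauss's identity (gauss_psi) expand the last
two factors, up to a factor 2 each:
  2 f_1^3     = sum_x +-x q^((x^2 - 1)/8),
  2 f_4^2/f_2 = sum_y q^((y^2 - 1)/4),
over odd integers x and y.  A term of their product has exponent i with
8 i + 3 = x^2 + 2 y^2.  If i = 4 mod 5 then x^2 + 2 y^2 = 0 mod 5, and as -2 is
not a square mod 5, x = 0 mod 5: the coefficient of the term vanishes in 'F_5.
Over 'F_5, fifth powers have only exponents divisible by 5 (their derivative is
0), so multiplying or dividing by them preserves the vanishing of the
coefficients with index 4 mod 5 (coefM_progression, coefM_progression_inv).

Power series are replaced by polynomials modulo 'X^N for a large N, and infinite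
products by long finite ones.  The identities of Jacobi and Gauss then come from
a finite form of the triple product identity (coef_jtp), whose coefficients are
Gaussian binomials, each congruent to 1 / f_d unless its power of q is already
beyond 'X^N (gauss_bin_trunc).  On the combinatorial side, all partitions with
parts at most m and with bounded multiplicities are listed (bounded_mult); their
generating polynomial is by construction a product over the part sizes. *)

(** * Partitions with bounded parts and multiplicities *)

(** The partitions with parts at most [m] in which each part [i] occurs at most
[w i] times: a choice of one multiplicity for each part size, so that the
generating polynomial factors.  Distinct odd parts and multiples of 4 are two
instances. *)
Fixpoint bounded_mult (w : nat -> nat) (m : nat) : seq (seq nat) :=
  if m is m'.+1 then
    [seq nseq j m ++ s | j <- iota 0 (w m).+1, s <- bounded_mult w m']
  else [:: [::]].

Lemma bounded_multS w m :
  bounded_mult w m.+1 =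
    [seq nseq j m.+1 ++ s | j <- iota 0 (w m.+1).+1, s <- bounded_mult w m].
Proof. by []. Qed.

Lemma mem_bounded_mult w m s :
  reflect [/\ is_partition s, forall i, i \in s -> i <= m
            & forall i, count_mem i s <= w i]
          (s \in bounded_mult w m).
Proof.
elim: m s => [|m IHm] s; last rewrite bounded_multS.
  rewrite inE; apply: (iffP eqP) => [-> | [/andP[_ s0] sm _]]; first by split.
  case: s s0 sm => // x s s0 /(_ x (mem_head x s)).
  by rewrite leqn0 => /eqP x0; rewrite x0 in_cons eqxx in s0.
apply: (iffP allpairsP) => [[[j t] [jw tB ->]] | [/andP[ss s0] sm sw]].
  rewrite mem_iota add0n in jw.
  have /IHm[/andP[st t0] tm tw] : t \in bounded_mult w m by [].
  split=> [| i | i].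
  - rewrite /is_partition mem_cat mem_nseq negb_or t0 andbF !andbT.
    elim: j {jw tB} => //= j IHj; rewrite path_sortedE; last exact/rev_trans/leq_trans.
    rewrite IHj andbT all_cat all_nseq /= leqnn orbT /=.
    by apply/allP => i /tm /leqW.
  - by rewrite mem_cat mem_nseq => /orP[/andP[_ /eqP->] | /tm /leqW].
  - rewrite count_cat count_nseq /=; case: eqP => [<- | _]; last exact: tw.
    rewrite mul1n; have /count_memPn-> : m.+1 \notin t.
      by apply/negP => /tm; rewrite ltnn.
    by rewrite addn0.
(* in a nonincreasing sequence the copies of the greatest value come first *)
have [t def_s tm] : exists2 t, s = nseq (count_mem m.+1 s) m.+1 ++ t
                       & forall i, i \in t -> i <= m.
  elim: s ss sm {s0 sw} => [|x s IHs] /= ss sm; first by exists [::].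
  have [t def_s tm] := IHs (path_sorted ss) (fun i si => sm i (mem_behead (s := x :: s) si)).
  case: eqP => [-> | /eqP xm]; first by exists t => //=; rewrite -def_s.
  move: ss; rewrite path_sortedE => [/andP[/allP xs _]|]; last exact/rev_trans/leq_trans.
  have lexm : x <= m by have := sm x (mem_head x s); lia.
  have /count_memPn-> : m.+1 \notin s.
    by apply/negP => /xs /=; lia.
  exists (x :: s) => // i; rewrite inE => /orP[/eqP-> // | /xs /= ix].
  exact: leq_trans lexm.
exists (count_mem m.+1 s, t); split=> //; first by rewrite mem_iota add0n ltnS /=.
apply/IHm; split=> // [|i].
  apply/andP; split; last by move: s0; rewrite def_s mem_cat negb_or => /andP[].
  apply: subseq_sorted ss; first exact/rev_trans/leq_trans.
  by rewrite {2}def_s suffix_subseq.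
by apply: leq_trans (sw i); rewrite {2}def_s count_cat leq_addl.
Qed.

Lemma uniq_bounded_mult w m : uniq (bounded_mult w m).
Proof.
elim: m => // m IHm; rewrite bounded_multS.
apply: allpairs_uniq => //; first exact: (iota_uniq 0 (w m.+1).+1).
have count_top j t : t \in bounded_mult w m -> count_mem m.+1 (nseq j m.+1 ++ t) = j.
  move=> /mem_bounded_mult[_ tm _]; rewrite count_cat count_nseq /= eqxx mul1n.
  have /count_memPn-> : m.+1 \notin t by apply/negP => /tm; rewrite ltnn.
  by rewrite addn0.
move=> p p' /allpairsP[[j t] [_ tm ->]] /allpairsP[[j' t'] [_ tm' ->]] /= eq_st.
have eq_j : j = j' by rewrite -(count_top j t) // -(count_top j' t') // eq_st.
move: eq_st; rewrite eq_j => /eqP; rewrite eqseq_cat // eqxx.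
by move=> /eqP->.
Qed.

Local Open Scope ring_scope.

Lemma sum_bounded_mult (R : comNzRingType) w m :
  \sum_(s <- bounded_mult w m) 'X^(sumn s) =
    \prod_(i < m) \sum_(j < (w i.+1).+1) 'X^(j * i.+1) :> {poly R}.
Proof.
elim: m => [|m IHm]; first by rewrite big_ord0 big_seq1.
rewrite bounded_multS [LHS]big_flatten big_map big_ord_recr /= -IHm mulrC.
rewrite -(big_mkord xpredT (fun j => 'X^(j * m.+1))) mulr_suml /index_iota subn0 /=.
apply: eq_bigr => j _; rewrite big_map mulr_sumr; apply: eq_bigr => s _ /=.
by rewrite sumn_cat sumn_nseq exprD mulnC.
Qed.

(** * The generating polynomial of admissible triples *)

Definition odd_mult (i : nat) : nat := odd i.

(** For partitions of numbers up to [m], [m] is as good as no bound. *)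
Definition dvd4_mult (m i : nat) : nat := if (4 %| i)%N then m else 0.

Definition distinct_odd_poly (R : comNzRingType) m : {poly R} :=
  \sum_(s <- bounded_mult odd_mult m) 'X^(sumn s).
Definition dvd4_poly (R : comNzRingType) m : {poly R} :=
  \sum_(s <- bounded_mult (dvd4_mult m) m) 'X^(sumn s).

Lemma mem_leq_sumn (s : seq nat) i : i \in s -> (i <= sumn s)%N.
Proof.
elim: s => //= x s IHs; rewrite inE => /orP[/eqP-> | /IHs]; lia.
Qed.

Lemma size_leq_sumn (s : seq nat) : 0%N \notin s -> (size s <= sumn s)%N.
Proof.
elim: s => //= x s IHs; rewrite inE negb_or => /andP[x0 /IHs]; lia.
Qed.

Lemma mem_distinct_odd m s : (sumn s <= m)%N ->
  (s \in bounded_mult odd_mult m) = is_partition s && distinct_odd_parts s.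
Proof.
move=> sm; apply/mem_bounded_mult/idP => [[ps _ sw] | /and3P[ps us /allP os]].
  apply/and3P; split=> //.
    apply: count_mem_uniq => i; have := sw i.
    rewrite -has_pred1 has_count /odd_mult; case: odd; lia.
  apply/allP => i; rewrite -has_pred1 has_count => si.
  by have := leq_trans si (sw i); rewrite /odd_mult; case: odd.
split=> // i; first by move=> /mem_leq_sumn /leq_trans; apply.
rewrite count_uniq_mem // /odd_mult.
by case: (boolP (i \in s)) => // /os ->.
Qed.

Lemma mem_dvd4 m s : (sumn s <= m)%N ->
  (s \in bounded_mult (dvd4_mult m) m) = is_partition s && parts_dvd4 s.
Proof.
move=> sm; apply/mem_bounded_mult/idP => [[ps _ sw] | /andP[ps /allP os]].
  apply/andP; split=> //.
  apply/allP => i; rewrite -has_pred1 has_count => si.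
  by have := leq_trans si (sw i); rewrite /dvd4_mult; case: ifP.
split=> // i; first by move=> /mem_leq_sumn /leq_trans; apply.
rewrite /dvd4_mult; case: ifPn => [_ | i4].
  by rewrite (leq_trans (count_size _ _)) // (leq_trans _ sm) // size_leq_sumn //; case/andP: ps.
by rewrite leqn0; apply/eqP/count_memPn/negP => /os; apply/negP.
Qed.

(** The product runs over all triples of listed partitions, and those of total
size [n] are exactly the admissible triples that [B n] counts. *)
Lemma coef_triples (R : comNzRingType) m n : (n <= m)%N ->
  (distinct_odd_poly R m ^+ 2 * dvd4_poly R m)`_n = (B n)%:R.
Proof.
move=> nm; pose D := bounded_mult odd_mult m; pose P := bounded_mult (dvd4_mult m) m.
pose T := [seq (p, s3) | p <- [seq (s1, s2) | s1 <- D, s2 <- D], s3 <- P].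
pose wt (p : seq nat * seq nat * seq nat) := (sumn p.1.1 + sumn p.1.2 + sumn p.2)%N.
have -> : distinct_odd_poly R m ^+ 2 * dvd4_poly R m = \sum_(p <- T) 'X^(wt p).
  rewrite /distinct_odd_poly /dvd4_poly big_allpairs_dep big_allpairs_dep expr2 2!mulr_suml.
  apply: eq_bigr => s1 _; rewrite [X in X * _]mulr_sumr mulr_suml; apply: eq_bigr => s2 _ /=.
  by rewrite mulr_sumr; apply: eq_bigr => s3 _ /=; rewrite -!exprD.
rewrite coef_sum (B_count (L := [seq p <- T | wt p == n])).
- rewrite size_filter -sum1_count natr_sum [RHS]big_mkcond /=.
  by apply: eq_bigr => p _; rewrite coefXn eq_sym; case: eqP.
- rewrite filter_uniq //; apply: allpairs_uniq; last by move=> [? ?] [? ?].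
    by apply: allpairs_uniq; [exact: uniq_bounded_mult..| move=> [? ?] [? ?]].
  exact: uniq_bounded_mult.
- move=> [[s1 s2] s3]; rewrite mem_filter /wt /=.
  case: eqP => [eqn | _] /=; last by rewrite !andbF.
  have -> : ((s1, s2, s3) \in T) = [&& s1 \in D, s2 \in D & s3 \in P].
    apply/allpairsP/and3P => [[[p t] /= [/allpairsP[[t1 t2] /= [? ? ->]] ? [-> -> ->]]] // | [? ? ?]].
    exists ((s1, s2), s3); split=> //=.
    by apply/allpairsP; exists (s1, s2).
  rewrite /D /P !mem_distinct_odd ?mem_dvd4; lia.
Qed.

(** * Exponents in characteristic l, and the parity statement *)

(** The coefficient of [p] at [i] is multiplied by [i], a unit, in the
derivative.  For [p] an [l]-th power this replaces Frobenius. *)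
Lemma coef_deriv0 (K : fieldType) l (p : {poly K}) i :
  l \in [pchar K] -> p^`() = 0 -> ~~ (l %| i)%N -> p`_i = 0.
Proof.
case: i => [|i] chK p0 li; first by rewrite dvdn0 in li.
have := coef_deriv p i; rewrite p0 coef0 -mulr_natr => /esym/eqP.
by rewrite mulf_eq0 -(dvdn_pcharf chK) (negbTE li) orbF => /eqP.
Qed.

Lemma deriv_pchar_exp (K : fieldType) l (p : {poly K}) :
  l \in [pchar K] -> (p ^+ l)^`() = 0.
Proof.
move=> chK; rewrite deriv_exp -mulr_natr -polyC_natr.
by rewrite (pcharf0 chK) polyC0 mulr0.
Qed.

Lemma B_odd n : B (2 * n + 1) = 0 %[mod 2].
Proof.
have ch2 : 2%N \in [pchar 'F_2] by exact: pchar_Fp.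
apply/eqP; rewrite mod0n -/(dvdn 2 _) (dvdn_pcharf ch2).
rewrite -(coef_triples 'F_2 (leqnn _)); apply/eqP/(coef_deriv0 ch2); last by lia.
rewrite derivM deriv_pchar_exp // mul0r add0r raddf_sum big_seq big1 ?mulr0 // => s.
move=> /mem_bounded_mult[_ _ sw] /=; rewrite derivXn -mulr_natr -polyC_natr.
have /allP s4 : all (dvdn 4) s.
  apply/allP => i; rewrite -has_pred1 has_count => si.
  by have := leq_trans si (sw i); rewrite /dvd4_mult; case: ifP.
suff: (2 %| sumn s)%N by rewrite (dvdn_pcharf ch2) => /eqP->; rewrite polyC0 mulr0.
rewrite sumnE big_seq; apply: dvdn_sum => i /s4; exact: dvdn_trans.
Qed.

(** * Gaussian binomials and the finite triple product *)

Definition qpoch (R : comNzRingType) (q : R) n : R := \prod_(i < n) (1 - q ^+ i.+1).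

Fixpoint gauss_bin (R : comNzRingType) (q : R) n k : R :=
  match n, k with
  | _, 0 => 1
  | 0, _.+1 => 0
  | n'.+1, k'.+1 => gauss_bin q n' k + q ^+ (n' - k') * gauss_bin q n' k'
  end.

Lemma gauss_bin0 (R : comNzRingType) (q : R) n : gauss_bin q n 0 = 1.
Proof. by case: n. Qed.

Lemma gauss_bin_small (R : comNzRingType) (q : R) n k :
  (n < k)%N -> gauss_bin q n k = 0.
Proof.
elim: n k => [|n IHn] [|k] //=; rewrite ltnS => nk.
by rewrite !IHn ?mulr0 ?addr0 // ltnW.
Qed.

Lemma qpochS (R : comNzRingType) (q : R) n :
  qpoch q n.+1 = qpoch q n * (1 - q ^+ n.+1).
Proof. exact: big_ord_recr. Qed.

Lemma gauss_bin_fact (R : comNzRingType) (q : R) n k : (k <= n)%N ->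
  gauss_bin q n k * qpoch q k * qpoch q (n - k) = qpoch q n.
Proof.
elim: n k => [|n IHn] [|k] //=; rewrite ?gauss_bin0.
- by rewrite /qpoch !big_ord0 !mulr1.
- by rewrite /qpoch big_ord0 subn0 !mul1r.
rewrite ltnS subSS => kn; have IHk := IHn _ kn.
rewrite [RHS]qpochS !mulrDl qpochS.
have -> : q ^+ (n - k) * gauss_bin q n k * (qpoch q k * (1 - q ^+ k.+1)) *
    qpoch q (n - k) = q ^+ (n - k) * (1 - q ^+ k.+1) * qpoch q n by rewrite -IHk; ring.
have [-> | ltkn] := eqVneq k n.
  by rewrite gauss_bin_small // subnn expr0; ring.
have{} ltkn : (k < n)%N by lia.
have -> : (n - k = (n - k.+1).+1)%N by lia.
have -> : n.+1 = ((n - k.+1).+1 + k.+1)%N by lia.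
rewrite qpochS exprD -(IHn _ ltkn) qpochS; ring.
Qed.

(** The q-binomial theorem of Rothe. *)
Lemma coef_rothe (R : comNzRingType) (q y : R) n k :
  (\prod_(i < n) (y%:P + q ^+ i *: 'X))`_k =
    q ^+ 'C(k, 2) * gauss_bin q n k * y ^+ (n - k).
Proof.
elim: n k => [|n IHn] k.
  by rewrite big_ord0 coef1 sub0n; case: k => [|k]; rewrite ?expr0 !(mulr1, mulr0).
rewrite big_ord_recr /= mulrDr coefD coefMC -scalerAr coefZ coefMX IHn.
case: k => [|k] /=; first by rewrite !gauss_bin0 !subn0 exprSr; ring.
rewrite IHn subSS binS bin1 exprD.
have [ltkn | lenk] := ltnP k n.
  have -> : (n - k = (n - k.+1).+1)%N by lia.
  have -> : q ^+ n = q ^+ (n - k.+1).+1 * q ^+ k by rewrite -exprD; congr (_ ^+ _); lia.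
  rewrite [y ^+ _.+1]exprSr; ring.
rewrite (gauss_bin_small _ (_ : n < k.+1)%N) // mulr0 !mul0r add0r.
have [-> | nek] := eqVneq k n; first by rewrite subnn; ring.
rewrite (gauss_bin_small _ (_ : n < k)%N); last lia.
by rewrite !(mulr0, mul0r, addr0).
Qed.

(** This is d (d - 1) / 2 for the integer d = k - m: truncation of the
subtractions kills the second binomial if d > 0 and the first if d <= 0. *)
Definition jtp_exp m k : nat := ('C(k - m, 2) + 'C(m.+1 - k, 2))%N.

Lemma bin2_double n : ('C(n, 2) * 2 = n * n.-1)%N.
Proof. by rewrite bin2 muln2 -[RHS](odd_double_half) oddM; case: n => //= n; case: odd. Qed.

Lemma jtp_exp_rothe m k : (k <= m + m)%N ->
  ('C(k, 2) + m * (m + m - k) = jtp_exp m k + ('C(m, 2) + m * m))%N.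
Proof.
move=> kmm; apply/eqP; rewrite -(eqn_pmul2r (isT : 0 < 2)%N) !mulnDl !bin2_double.
apply/eqP; have [lekm | ltmk] := leqP k m.
  have -> : (k - m = 0)%N by lia.
  by case: k lekm {kmm} => [|k] lekm /=; nia.
have -> : (m.+1 - k = 0)%N by lia.
by case: k ltmk kmm => [|k] ltmk kmm //=; nia.
Qed.

(** The finite Jacobi triple product, in the variable ['X]. *)
Definition jtp_poly (R : comNzRingType) (q : R) m : {poly R} :=
  \prod_(j < m) ((q ^+ j.+1)%:P + 'X) * \prod_(j < m) (1 + q ^+ j *: 'X).

(** The theorem of Rothe for [m + m] factors and [y = q ^+ m]: a power of [q] can
be taken out of every factor, out of the first half to leave
[q ^+ j.+1 + 'X] and out of the second half to leave [1 + q ^+ j *: 'X]; on the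
other side the exponents become quadratic in [k - m]. *)
Lemma coef_jtp (R : idomainType) (q : R) m k : q != 0 ->
  (jtp_poly q m)`_k = q ^+ jtp_exp m k * gauss_bin q (m + m) k.
Proof.
move=> q0; apply: (@mulfI _ (q ^+ ('C(m, 2) + m * m))); first by rewrite expf_neq0.
have -> : q ^+ ('C(m, 2) + m * m) * (jtp_poly q m)`_k =
          (\prod_(i < m + m) ((q ^+ m)%:P + q ^+ i *: 'X))`_k.
  rewrite -coefZ big_split_ord /=; congr _`_k.
  have -> : \prod_(i < m) ((q ^+ m)%:P + q ^+ (m + i) *: 'X) =
            q ^+ (m * m) *: \prod_(i < m) (1 + q ^+ i *: 'X).
    under eq_bigr => i _ do rewrite exprD -scalerA.
    rewrite (eq_bigr (fun i : 'I_m => q ^+ m *: (1 + q ^+ i *: 'X))).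
      by rewrite scaler_prod prodr_const card_ord exprM.
    by move=> i _; rewrite scalerDr alg_polyC.
  have <- : q ^+ 'C(m, 2) *: \prod_(j < m) ((q ^+ j.+1)%:P + 'X) =
            \prod_(i < m) ((q ^+ m)%:P + q ^+ i *: 'X).
    rewrite (reindex_inj rev_ord_inj) -bin2_sum big_mkord -prodrXr -scaler_prod /=.
    apply: eq_bigr => i _; rewrite scalerDr -mul_polyC -polyCM -exprD.
    by congr ((q ^+ _)%:P + _); rewrite subnSK // subnKC // ltnW.
  by rewrite -scalerAl -scalerAr scalerA -exprD.
rewrite coef_rothe.
have [lekm | ltmk] := leqP k (m + m).
  by rewrite mulrA -exprD addnC -jtp_exp_rothe // exprD exprM; ring.
by rewrite gauss_bin_small // !(mulr0, mul0r).
Qed.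

Lemma jtp_polyE (R : idomainType) (q : R) m : q != 0 ->
  jtp_poly q m = \poly_(k < (m + m).+1) (q ^+ jtp_exp m k * gauss_bin q (m + m) k).
Proof.
move=> q0; apply/polyP => k; rewrite coef_poly coef_jtp //.
by case: ltnP => // km; rewrite gauss_bin_small ?mulr0.
Qed.

Lemma jtp_poly_factor (R : comNzRingType) (q : R) m :
  jtp_poly q m.+1 = (1 + 'X) * (\prod_(j < m.+1) ((q ^+ j.+1)%:P + 'X) *
                                \prod_(j < m) (1 + q ^+ j.+1 *: 'X)).
Proof. by rewrite /jtp_poly [X in _ * X]big_ord_recl /= expr0 scale1r mulrCA. Qed.

(** The finite triple product at [1]. *)
Lemma gauss_finite (R : idomainType) (q : R) m : q != 0 ->
  \sum_(k < (m.+1 + m.+1).+1) q ^+ jtp_exp m.+1 k * gauss_bin q (m.+1 + m.+1) k =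
    2 * \prod_(j < m.+1) (1 + q ^+ j.+1) * \prod_(j < m) (1 + q ^+ j.+1).
Proof.
move=> q0; have := congr1 (horner^~ 1) (jtp_polyE m.+1 q0).
rewrite horner_poly jtp_poly_factor !hornerM hornerD hornerX -(polyC1 R) hornerC.
have -> : (\prod_(j < m.+1) ((q ^+ j.+1)%:P + 'X)).[1] = \prod_(j < m.+1) (1 + q ^+ j.+1).
  by rewrite horner_prod; apply: eq_bigr => j _; rewrite !hornerE addrC.
have -> : (\prod_(j < m) (1%:P + q ^+ j.+1 *: 'X)).[1] = \prod_(j < m) (1 + q ^+ j.+1).
  by rewrite horner_prod; apply: eq_bigr => j _; rewrite !hornerE.
by rewrite mulrA => ->; apply: eq_bigr => k _; rewrite expr1n mulr1.
Qed.

(** The finite triple product [p] has the root [-1], with cofactor [g], and so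
[g.[-1]] is the derivative of [p] at [-1].  Adding a multiple of [p.[-1] = 0]
turns the weight [k] of the derivative into x = 2 k - (2 m.+1 + 1), the odd
number for which the exponent of [q] is (x^2 - 1) / 8. *)
Lemma jacobi_finite (R : idomainType) (q : R) m : q != 0 ->
  \sum_(k < (m.+1 + m.+1).+1) (-1) ^+ (m + k) * ((k.*2)%:R - (m.+1).*2.+1%:R) *
      (q ^+ jtp_exp m.+1 k * gauss_bin q (m.+1 + m.+1) k) =
    2 * qpoch q m.+1 * qpoch q m.
Proof.
move=> q0; pose g : {poly R} := \prod_(j < m.+1) ((q ^+ j.+1)%:P + 'X) *
                    \prod_(j < m) (1 + q ^+ j.+1 *: 'X).
have def_p : jtp_poly q m.+1 = (1 + 'X) * g := jtp_poly_factor q m.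
have g1 : g.[-1] = (-1) ^+ m.+1 * (qpoch q m.+1 * qpoch q m).
  rewrite hornerM !horner_prod mulrA; congr (_ * _).
    rewrite /qpoch -[X in _ ^+ X](card_ord m.+1) -prodr_const -big_split /=.
    by apply: eq_bigr => j _; rewrite !hornerE; ring.
  by apply: eq_bigr => j _; rewrite !hornerE; ring.
have p1 : (jtp_poly q m.+1).[-1] = 0.
  by rewrite def_p; move: (g) => h; rewrite !hornerE; ring.
have p'1 : (jtp_poly q m.+1)^`().[-1] = g.[-1].
  by rewrite def_p; move: (g) => h; rewrite derivM derivD derivX derivC !hornerE; ring.
have signm : (-1) ^+ m * (-1) ^+ m = 1 :> R by rewrite -expr2 sqrr_sign.
transitivity
  ((-1) ^+ m * (- 2 * g.[-1] - (m.+1).*2.+1%:R * (jtp_poly q m.+1).[-1])); last first.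
  rewrite p1 g1 exprS.
  transitivity ((-1) ^+ m * (-1) ^+ m * (2 * qpoch q m.+1 * qpoch q m)); first ring.
  by rewrite signm mul1r.
rewrite -p'1 jtp_polyE // poly_def raddf_sum /= !horner_sum.
rewrite !mulr_sumr -sumrB mulr_sumr; apply: eq_bigr => k _.
move: (q ^+ _ * _) => c.
rewrite linearZ /= derivXn !hornerZ hornerMn !hornerXn exprD -muln2 natrM -mulr_natr.
by case: (k : nat) => [|i] /=; rewrite ?exprS; ring.
Qed.

(** * Congruence modulo a power of the variable *)

Definition eqX (K : fieldType) N (p r : {poly K}) := 'X^N %| p - r.

Lemma eqX_refl (K : fieldType) N (p : {poly K}) : eqX N p p.
Proof. by rewrite /eqX subrr dvdp0. Qed.

Lemma eqX_sym (K : fieldType) N (p r : {poly K}) : eqX N p r -> eqX N r p.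
Proof. by rewrite /eqX -[r - p]opprB dvdpNr. Qed.

Lemma eqX_trans (K : fieldType) N (r p s : {poly K}) :
  eqX N p r -> eqX N r s -> eqX N p s.
Proof. by move=> pr rs; rewrite /eqX -[p - s](subrKA r); apply: dvdp_add. Qed.

Lemma eqXD (K : fieldType) N (p r p' r' : {poly K}) :
  eqX N p r -> eqX N p' r' -> eqX N (p + p') (r + r').
Proof. by move=> pr pr'; rewrite /eqX opprD addrACA; apply: dvdp_add. Qed.

Lemma eqXM (K : fieldType) N (p r p' r' : {poly K}) :
  eqX N p r -> eqX N p' r' -> eqX N (p * p') (r * r').
Proof.
move=> pr pr'; rewrite /eqX.
have -> : p * p' - r * r' = (p - r) * p' + r * (p' - r') by ring.
by apply: dvdp_add; [apply: dvdp_mulr | apply: dvdp_mull].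
Qed.

Lemma eqX_sum (K : fieldType) N (I : finType) (F F' : I -> {poly K}) :
  (forall i, eqX N (F i) (F' i)) -> eqX N (\sum_i F i) (\sum_i F' i).
Proof.
move=> FF'; elim/big_ind2: _ => // [|p p' r r']; first exact: eqX_refl.
exact: eqXD.
Qed.

Lemma eqX_prod1 (K : fieldType) N (I : finType) (F : I -> {poly K}) :
  (forall i, eqX N (F i) 1) -> eqX N (\prod_i F i) 1.
Proof.
move=> F1; elim/big_ind: _ => // [|p r p1 r1]; first exact: eqX_refl.
by rewrite -[1]mulr1; apply: eqXM.
Qed.

Lemma eqX_Xn (K : fieldType) N n : (N <= n)%N -> eqX N ('X^n : {poly K}) 0.
Proof. by move=> Nn; rewrite /eqX subr0 dvdp_exp2l. Qed.

(** A polynomial with nonzero constant term is invertible modulo ['X^N]. *)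
Lemma eqXMr (K : fieldType) N (s p r : {poly K}) :
  s`_0 != 0 -> eqX N (p * s) (r * s) -> eqX N p r.
Proof.
move=> s0; rewrite /eqX -mulrBl Gauss_dvdpl // coprimep_expl // coprimep_sym.
by rewrite coprimepX rootE horner_coef0.
Qed.

Lemma coef_eqX (K : fieldType) N (p r : {poly K}) i :
  eqX N p r -> (i < N)%N -> p`_i = r`_i.
Proof.
move=> /dvdpP[s def_s] iN; apply/eqP; rewrite -subr_eq0 -coefB def_s.
by rewrite mulrC coefXnM iN.
Qed.

(** * The identities of Jacobi and Gauss *)

Lemma qpoch_coef0 (K : fieldType) d n :
  (0 < d)%N -> (qpoch 'X^d n : {poly K})`_0 = 1.
Proof.
move=> d_gt0; rewrite -horner_coef0 horner_prod big1 // => i _.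
by rewrite !hornerE -exprM expr0n /= muln_eq0 /= (gtn_eqF d_gt0) subr0.
Qed.

Lemma qpoch_trunc (K : fieldType) d N n : (0 < d)%N -> (N <= n)%N ->
  eqX N (qpoch 'X^d n : {poly K}) (qpoch 'X^d N).
Proof.
move=> d_gt0; elim: n => [|n IHn]; first by rewrite leqn0 => /eqP->; apply: eqX_refl.
rewrite leq_eqVlt => /orP[/eqP-> | Nn]; first exact: eqX_refl.
rewrite qpochS -[X in eqX _ _ X]mulr1; apply: eqXM; first exact: IHn.
rewrite /eqX addrAC subrr add0r dvdpNr -exprM dvdp_exp2l //.
by apply: leq_trans (ltnW Nn) _; apply: leq_pmull.
Qed.

(** If [k] is at distance at least [N] from both ends, the factorial formula
gives the Gaussian binomial the value 1 / (q; q)_N, as a q-Pochhammer symbol of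
length at least [N] is (q; q)_N modulo ['X^N].  Otherwise [k] is far from [m],
and the quadratic exponent is at least [N]: both sides vanish. *)
Lemma gauss_bin_trunc (K : fieldType) d N m k :
  (0 < d)%N -> (0 < N)%N -> (N.*2 <= m)%N -> (k <= m + m)%N ->
  eqX N ('X^d ^+ jtp_exp m k * gauss_bin 'X^d (m + m) k * qpoch 'X^d N : {poly K})
    ('X^d ^+ jtp_exp m k).
Proof.
move=> d_gt0 N0 Nm km.
have [/andP[Nk Nmk] | outer] := boolP (N <= k <= m + m - N)%N.
  rewrite -[X in eqX _ _ X]mulr1 -mulrA; apply: eqXM; first exact: eqX_refl.
  apply: (@eqXMr _ _ (qpoch 'X^d N)); first by rewrite qpoch_coef0 // oner_eq0.
  rewrite mul1r; apply: (@eqX_trans _ _ (qpoch 'X^d (m + m))).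
    rewrite -(gauss_bin_fact 'X^d km); apply: eqXM; first apply: eqXM.
    - exact: eqX_refl.
    - by apply/eqX_sym/qpoch_trunc.
    - by apply/eqX_sym/qpoch_trunc; lia.
  by apply: qpoch_trunc; lia.
have big_exp : (N <= jtp_exp m k)%N.
  have binN n : (N < n)%N -> (N <= 'C(n, 2))%N.
    by case: n => // n Nn; rewrite binS bin1; lia.
  rewrite /jtp_exp; case: (leqP N k) outer => [Nk | kN] outer.
    by apply: leq_trans (leq_addr _ _); apply: binN; lia.
  by apply: leq_trans (leq_addl _ _); apply: binN; lia.
have t0 : eqX N ('X^d ^+ jtp_exp m k : {poly K}) 0.
  by rewrite -exprM; apply: eqX_Xn; apply: leq_trans big_exp _; apply: leq_pmull.
apply: eqX_trans (eqX_sym t0); rewrite -mulrA.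
rewrite -[X in eqX _ _ X](mul0r (gauss_bin 'X^d (m + m) k * qpoch 'X^d N)).
by apply: eqXM => //; apply: eqX_refl.
Qed.

(** Jacobi's identity for the cube of the Euler function, with the sum over all
odd integers x = 2 k - (2 m.+1 + 1), so that x and -x give the same term, up to
terms beyond ['X^N]; whence the factor 2. *)
Lemma jacobi_cube (K : fieldType) d N m :
  (0 < d)%N -> (0 < N)%N -> (N.*2 <= m.+1)%N ->
  eqX N (2 * qpoch 'X^d N ^+ 3 : {poly K})
    (\sum_(k < (m.+1 + m.+1).+1)
       (-1) ^+ (m + k) * ((k.*2)%:R - (m.+1).*2.+1%:R) * 'X^d ^+ jtp_exp m.+1 k).
Proof.
move=> d_gt0 N0 Nm; set f : {poly K} := qpoch 'X^d N.
have fE n : (N <= n)%N -> eqX N f (qpoch 'X^d n).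
  by move=> Nn; apply/eqX_sym/qpoch_trunc.
apply: (@eqX_trans _ _ (2 * qpoch 'X^d m.+1 * qpoch 'X^d m * f)).
  have -> : 2 * f ^+ 3 = 2 * f * f * f by ring.
  apply: eqXM; last exact: eqX_refl.
  apply: eqXM; last by apply: fE; lia.
  by apply: eqXM; [exact: eqX_refl | apply: fE; lia].
rewrite -jacobi_finite ?expf_neq0 ?polyX_eq0 // mulr_suml; apply: eqX_sum => k.
rewrite -[X in eqX _ X _]mulrA; apply: eqXM; first exact: eqX_refl.
by apply: gauss_bin_trunc => //; rewrite -ltnS.
Qed.

(** This is (1 + x) (1 - x) = 1 - x^2 in each factor. *)
Lemma qpoch_pm (R : comNzRingType) (q : R) n :
  \prod_(i < n) (1 + q ^+ i.+1) * qpoch q n = qpoch (q ^+ 2) n.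
Proof.
rewrite -big_split /=; apply: eq_bigr => i _.
by rewrite -exprM mulnC exprM; ring.
Qed.

(** This is psi(q) = f_2^2 / f_1 at q = 'X^d, where psi sums the powers of [q] with
triangular exponents; up to terms beyond ['X^N], each of them occurs twice here. *)
Lemma gauss_psi (K : fieldType) d N m : (0 < d)%N -> (0 < N)%N -> (N.*2 <= m.+1)%N ->
  eqX N (2 * qpoch ('X^(d * 2) : {poly K}) N ^+ 2)
    (qpoch 'X^d N * \sum_(k < (m.+1 + m.+1).+1) ('X^d : {poly K}) ^+ jtp_exp m.+1 k).
Proof.
move=> d0 N0 Nm; have d20 : (0 < d * 2)%N by lia.
pose F e := qpoch ('X^e : {poly K}) N.
pose p n := \prod_(j < n) (1 + ('X^d : {poly K}) ^+ j.+1).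
have pF n : (N <= n)%N -> eqX N (p n * F d) (F (d * 2)%N).
  move=> Nn; apply: (@eqX_trans _ _ (p n * qpoch 'X^d n)).
    by apply: eqXM; [apply: eqX_refl | apply: eqX_sym; apply: qpoch_trunc].
  by rewrite qpoch_pm -exprM; apply: qpoch_trunc.
apply: (@eqX_trans _ _ (F d * (F d * (2 * p m.+1 * p m)))).
  have -> : F d * (F d * (2 * p m.+1 * p m)) = 2 * (p m.+1 * F d * (p m * F d)) by ring.
  apply: eqXM; first exact: eqX_refl.
  by rewrite expr2; apply: eqXM; apply: eqX_sym; apply: pF; lia.
apply: eqXM; first exact: eqX_refl.
rewrite -gauss_finite ?expf_neq0 ?polyX_eq0 // mulr_sumr; apply: eqX_sum => k.
by rewrite mulrC; apply: gauss_bin_trunc => //; rewrite -ltnS.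
Qed.

(** * The generating function as a product of Euler functions *)

Lemma prod_multiples (R : comNzRingType) d h (u : nat -> R) :
  (0 < d)%N -> (forall i, ~~ (d %| i)%N -> u i = 1) ->
  \prod_(i < d * h) u i.+1 = \prod_(i < h) u (d * i.+1)%N.
Proof.
case: d => // d _ u1; elim: h => [|h IHh]; first by rewrite muln0 !big_ord0.
rewrite mulnSr big_split_ord /= IHh [RHS]big_ord_recr /= big_ord_recr /=.
rewrite [\prod_(i < d) _]big1 => [|i _].
  by rewrite mul1r -addnS -mulnSr.
by apply: u1; rewrite -addnS dvdn_addr ?dvdn_mulr // gtnNdvd ?ltnS.
Qed.

(** The distinct odd parts complete the even ones to prod (1 + q^i) = f_2 / f_1,
and the even ones contribute f_4 / f_2. *)
Lemma distinct_odd_poly_qpoch (R : comNzRingType) h :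
  distinct_odd_poly R (2 * h) * qpoch 'X^4 h * qpoch 'X^1 (2 * h) =
    qpoch 'X^2 (2 * h) * qpoch 'X^2 h.
Proof.
pose even_part i : {poly R} := if (2 %| i)%N then 1 + 'X^1 ^+ i else 1.
have split_odd : distinct_odd_poly R (2 * h) * \prod_(i < 2 * h) even_part i.+1 =
                 \prod_(i < 2 * h) (1 + 'X^1 ^+ i.+1).
  rewrite /distinct_odd_poly sum_bounded_mult -big_split /=; apply: eq_bigr => i _.
  rewrite /even_part /odd_mult dvdn2; case: odd => /=; last first.
    by rewrite big_ord1 mul0n expr0 mul1r.
  by rewrite big_ord_recr big_ord1 /= mulr1 mul0n mul1n expr0 expr1.
have even_h : \prod_(i < 2 * h) even_part i.+1 = \prod_(i < h) (1 + 'X^2 ^+ i.+1).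
  rewrite prod_multiples // /even_part => [|i /negbTE-> //].
  by apply: eq_bigr => i _; rewrite dvdn_mulr // !exprM expr1.
have -> : 'X^4 = 'X^2 ^+ 2 :> {poly R} by rewrite -exprM.
rewrite -qpoch_pm -even_h mulrA split_odd mulrAC qpoch_pm.
by rewrite -exprM.
Qed.

(** Finite geometric series: the right-hand side is 1 modulo ['X^(4 * h)]. *)
Lemma dvd4_poly_qpoch (R : comNzRingType) h :
  dvd4_poly R (4 * h) * qpoch 'X^4 h =
    \prod_(i < h) (1 - 'X^(4 * i.+1 * (4 * h).+1)).
Proof.
pose u i : {poly R} := \sum_(j < (dvd4_mult (4 * h) i).+1) 'X^(j * i).
rewrite /dvd4_poly sum_bounded_mult (@prod_multiples _ 4 h u) //; last first.
  by move=> i i4; rewrite /u /dvd4_mult (negbTE i4) big_ord1 mul0n expr0.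
rewrite -big_split; apply: eq_bigr => i _ /=.
rewrite exprM -[RHS]opprB subrX1 mulrC -mulNr opprB -exprM; congr (_ * _).
rewrite /u /dvd4_mult dvdn_mulr //; apply: eq_bigr => j _.
by rewrite mulnC exprM.
Qed.

(** * The congruence modulo 5 *)

Lemma coefM_progression (R : comNzRingType) (p r : {poly R}) l c N :
  (forall i, ~~ (l %| i)%N -> p`_i = 0) ->
  (forall i, (i < N)%N -> i = c %[mod l] -> r`_i = 0) ->
  forall i, (i < N)%N -> i = c %[mod l] -> (p * r)`_i = 0.
Proof.
move=> p0 r0 i iN ic; rewrite coefM big1 // => j _.
have [lj | /p0->] := boolP (l %| j)%N; last by rewrite mul0r.
rewrite r0 ?mulr0 //; first by apply: leq_ltn_trans iN; apply: leq_subr.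
rewrite -ic -[in RHS](subnK (_ : j <= i)%N) -1?ltnS //.
by case/dvdnP: lj => s ->; rewrite addnC modnMDl.
Qed.

(** [p] is invertible as a power series, and its inverse is again supported on
multiples of [l]. *)
Lemma coefM_progression_inv (R : idomainType) (p r : {poly R}) l c N :
  p`_0 != 0 -> (forall i, ~~ (l %| i)%N -> p`_i = 0) ->
  (forall i, (i < N)%N -> i = c %[mod l] -> (p * r)`_i = 0) ->
  forall i, (i < N)%N -> i = c %[mod l] -> r`_i = 0.
Proof.
move=> p00 p0 pr0; elim/ltn_ind => i IHi iN ic.
have := pr0 i iN ic; rewrite coefM big_ord_recl subn0 big1 ?addr0.
  by move/eqP; rewrite mulf_eq0 (negbTE p00) => /eqP.
move=> j _; rewrite lift0.
have [lj | /p0->] := boolP (l %| j.+1)%N; last by rewrite mul0r.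
rewrite IHi ?mulr0 //; first by have := ltn_ord j; lia.
  by apply: leq_ltn_trans iN; apply: leq_subr.
rewrite -ic -[in RHS](subnK (ltn_ord j)).
by case/dvdnP: lj => s ->; rewrite addnC modnMDl.
Qed.

(** Completing the square in the exponents of the triple product. *)
Lemma jtp_exp_square (R : comNzRingType) m k :
  ((k.*2)%:R - m.*2.+1%:R) ^+ 2 = 8 * (jtp_exp m k)%:R + 1 :> R.
Proof.
have bin2E e : 2 * 'C(e.+1, 2)%:R = e.+1%:R * e%:R :> R.
  by rewrite -!natrM mulnC bin2_double.
have -> : 8 * (jtp_exp m k)%:R = 4 * (2 * (jtp_exp m k)%:R) :> R by ring.
rewrite /jtp_exp; have [lekm | ltmk] := leqP k m.
  have [e ->] : exists e, m = (k + e)%N by exists (m - k)%N; lia.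
  have -> : (k - (k + e) = 0)%N by lia.
  have -> : ((k + e).+1 - k = e.+1)%N by lia.
  by rewrite bin0n add0n bin2E -!muln2; ring.
have [e ->] : exists e, k = (m.+1 + e)%N by exists (k - m.+1)%N; lia.
have -> : (m.+1 - (m.+1 + e) = 0)%N by lia.
have -> : (m.+1 + e - m = e.+1)%N by lia.
by rewrite bin0n addn0 bin2E -!muln2; ring.
Qed.

(** -2 is not a square modulo 5. *)
Lemma F5_anisotropic (x y : 'F_5) : x ^+ 2 + 2 * y ^+ 2 = 0 -> x = 0.
Proof.
by case: x y => [[|[|[|[|[|x]]]]] hx] // [[|[|[|[|[|y]]]]] hy] // /eqP;
  rewrite // => _; apply/eqP.
Qed.

(** In the term with indices [k] and [l], 8 i + 3 = x^2 + 2 y^2 with x the weight of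
[k] and y that of [l], and 8 i + 3 = 0 in ['F_5]. *)
Lemma theta_product_coef m i : i = 4 %[mod 5] ->
  ((\sum_(k < (m.+1 + m.+1).+1)
       (-1) ^+ (m + k) * ((k.*2)%:R - (m.+1).*2.+1%:R) * 'X^1 ^+ jtp_exp m.+1 k) *
   \sum_(k < (m.+1 + m.+1).+1) 'X^2 ^+ jtp_exp m.+1 k : {poly 'F_5})`_i = 0.
Proof.
move=> i4; rewrite mulr_suml coef_sum big1 // => k _.
rewrite mulr_sumr coef_sum big1 // => l _.
pose x : 'F_5 := (k.*2)%:R - (m.+1).*2.+1%:R.
have -> : (k.*2)%:R - (m.+1).*2.+1%:R = x%:P by rewrite polyCB !polyC_natr.
rewrite -mulrA -!exprM -exprD -signr_odd -mulrA mul1n.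
have -> : (-1) ^+ odd (m + k) = ((-1) ^+ odd (m + k) : 'F_5)%:P by rewrite polyC_exp polyCN.
rewrite !coefCM coefXn; case: eqP => [def_i | _]; last by rewrite !mulr0.
suff -> : x = 0 by rewrite mul0r mulr0.
apply: (@F5_anisotropic _ ((l.*2)%:R - (m.+1).*2.+1%:R)).
rewrite !jtp_exp_square.
have /eqP i0 : (i + 1)%:R == 0 :> 'F_5.
  by rewrite -(dvdn_pcharf (pchar_Fp (isT : prime 5))); apply/eqP; rewrite -modnDml i4.
have -> : 8 * (jtp_exp m.+1 k)%:R + 1 + 2 * (8 * (jtp_exp m.+1 l)%:R + 1) =
   8 * (i + 1)%:R - 5%:R :> 'F_5 by rewrite def_i; ring.
by rewrite i0 mulr0 sub0r; apply/eqP.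
Qed.

Lemma B_5n4 n : B (5 * n + 4) = 0 %[mod 5].
Proof.
(* Triples of 5 n + 4 need parts up to 5 n + 4 only; 4 N is a bound on the parts
   for which the products over multiples of 2 and 4 have lengths 2 N and N. *)
pose N := (5 * n + 5)%N; have N0 : (0 < N)%N by rewrite /N; lia.
pose A := distinct_odd_poly 'F_5 (4 * N); pose P := dvd4_poly 'F_5 (4 * N).
pose f d := qpoch ('X^d : {poly 'F_5}) N.
pose J : {poly 'F_5} := \sum_(k < ((N.*2).+1 + (N.*2).+1).+1)
   (-1) ^+ (N.*2 + k) * ((k.*2)%:R - ((N.*2).+1).*2.+1%:R) * 'X^1 ^+ jtp_exp (N.*2).+1 k.
pose Psi : {poly 'F_5} := \sum_(k < ((N.*2).+1 + (N.*2).+1).+1) 'X^2 ^+ jtp_exp (N.*2).+1 k.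
have ch5 : 5%N \in [pchar 'F_5] by exact: pchar_Fp.
have fE d m : (0 < d)%N -> (N <= m)%N -> eqX N (f d) (qpoch 'X^d m).
  by move=> d0 Nm; apply/eqX_sym/qpoch_trunc.
have genA : eqX N (A * f 4 * f 1%N) (f 2 * f 2).
  apply: (@eqX_trans _ _ (A * qpoch 'X^4 (2 * N) * qpoch 'X^1 (2 * (2 * N)))).
    by apply: eqXM; [apply: eqXM; [exact: eqX_refl|] |]; apply: fE => //; lia.
  have -> : A = distinct_odd_poly 'F_5 (2 * (2 * N)) by rewrite mulnA.
  rewrite distinct_odd_poly_qpoch.
  by apply: eqXM; apply/eqX_sym/fE => //; lia.
have genP : eqX N (P * f 4) 1.
  rewrite /P /f dvd4_poly_qpoch; apply: eqX_prod1 => i.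
  rewrite /eqX addrAC subrr add0r dvdpNr dvdp_exp2l //; nia.
have cube : eqX N (2 * f 1%N ^+ 3) J by apply: jacobi_cube => //; lia.
have psi : eqX N (2 * f 4 ^+ 2) (f 2 * Psi).
  by apply: (@gauss_psi _ 2) => //; lia.
have key : eqX N (4 * (f 1%N * f 4) ^+ 5 * (A ^+ 2 * P)) (f 2 ^+ 5 * (J * Psi)).
  have -> : 4 * (f 1%N * f 4) ^+ 5 * (A ^+ 2 * P) =
      (A * f 4 * f 1%N) * (A * f 4 * f 1%N) * (P * f 4) *
      (2 * f 4 ^+ 2) * (2 * f 1%N ^+ 3) by ring.
  have -> : f 2 ^+ 5 * (J * Psi) = f 2 * f 2 * (f 2 * f 2) * 1 * (f 2 * Psi) * J by ring.
  by do 4![apply: eqXM => //].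
have fifth (p : {poly 'F_5}) i : ~~ (5 %| i)%N -> (p ^+ 5)`_i = 0.
  by apply: coef_deriv0 => //; apply: deriv_pchar_exp.
apply/eqP; rewrite mod0n -/(dvdn 5 _) (dvdn_pcharf ch5).
rewrite -(@coef_triples _ (4 * N)); last by rewrite /N; lia.
apply/eqP; apply: (@coefM_progression_inv _ (4 * (f 1%N * f 4) ^+ 5) _ 5 4 N); first last.
- by rewrite mulnC modnMDl.
- by rewrite /N; lia.
- move=> i iN i4; rewrite (coef_eqX key iN).
  apply: (@coefM_progression _ _ _ 5 4 N) => // j jN; [exact: fifth | exact: theta_product_coef].
- by move=> i i5; rewrite -polyC_natr coefCM fifth ?mulr0.
rewrite -polyC_natr coefCM -horner_coef0 !hornerE !horner_coef0 !qpoch_coef0 //.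
Qed.

Local Close Scope ring_scope.

Theorem theorem1p1 (n : nat) :
  B (2 * n + 1) = 0 %[mod 2] /\ B (5 * n + 4) = 0 %[mod 5].
Proof. by split; [exact: B_odd | exact: B_5n4]. Qed.
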